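(* Let $A=(a_1,\dots,a_n)$ be a finite sequence of real numbers with $a_i\le 1$ for every $i\in[n]$ and $S=\sum_{i=1}^n a_i\ge 0$, and let $k$ be a positive integer. Then there is a partition of $A$ into $k$ blocks $B_1,\dots,B_k$ such that $\max_{i} b_i\le \min_i b_i+1$, where $b_i$ is the size of $B_i$.
   Context: $[n]=\{1,\dots,n\}$. A block of a sequence $(a_1,\dots,a_n)$ is either the empty set or a set of consecutive terms $\{a_i,\dots,a_j\}$ with $i\le j$; its size is the sum of its elements (empty block has size $0$). A partition of $A$ into $k$ blocks is an ordered tuple $(B_1,\dots,B_k)$ given by integers $0=x_0\le x_1\le\dots\le x_k=n$ with $B_i=\{a_j:x_{i-1}<j\le x_i\}$ (empty blocks allowed). *)

(* Defs.v *)
From HB Require Import structures.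
From mathcomp Require Import all_boot all_order all_algebra.
From mathcomp Require Import reals.

Set Implicit Arguments.
Unset Strict Implicit.
Unset Printing Implicit Defensive.

Import Order.TTheory GRing.Theory Num.Theory.

Local Open Scope ring_scope.

(* A sequence (a_1, ..., a_n) is a function a : 'I_n -> R, with a_j stored at
   the ordinal of value j - 1. A block is represented by the set of positions
   of its terms, so that equal terms at different positions stay distinct. *)

(* The cut points are x 0, ..., x k; values of x beyond k play no role. With
   0-based positions, x_{i-1} < j <= x_i becomes x i <= j < x i.+1. *)
Definition is_block_partition (n k : nat) (B : 'I_k -> {set 'I_n}) : Prop :=
  exists x : nat -> nat,
    [/\ x 0%N = 0%N,
        x k = n,
        (forall i : nat, (i < k)%N -> (x i <= x i.+1)%N)
      & forall i : 'I_k, B i = [set j : 'I_n | (x i <= j < x i.+1)%N]].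

Definition block_size (R : realType) (n : nat) (a : 'I_n -> R)
    (B : {set 'I_n}) : R :=
  \sum_(j in B) a j.

(* The starting value of the iterated max (min) is itself one of the values,
   so these are the true maximum and minimum of b over the nonempty 'I_k. *)
Definition family_max (R : realType) (k : nat) (hk : (0 < k)%N)
    (b : 'I_k -> R) : R :=
  \big[Num.max/b (Ordinal hk)]_(i < k) b i.

Definition family_min (R : realType) (k : nat) (hk : (0 < k)%N)
    (b : 'I_k -> R) : R :=
  \big[Num.min/b (Ordinal hk)]_(i < k) b i.

(* Main.v *)
(* Scanning the prefix sums s_0 = 0, ..., s_n = S and keeping a new one only
   when it lies between the last one kept and S produces positions p_0 = 0,
   ..., p_n = n along which s is nondecreasing with increments at most 1: when
   s climbs above S the last kept value is already at least S - 1.  So one may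
   assume that the prefix sums v are nondecreasing.

   Let b be the least possible value of the largest block, attained by the cut
   points h, and let t = b - 1.  Cutting greedily as soon as a block reaches t
   gives cut points g whose blocks are smaller than b, except for the last one,
   which by minimality of b is at least b; so all blocks of g are at least t.
   Cut points with all blocks in [t, t + 1] are then found from right to left,
   squeezed between g and h. *)

Require Import Defs.
From HB Require Import structures.
From mathcomp Require Import all_boot all_order all_algebra.
From mathcomp Require Import reals.
From mathcomp Require Import zify lra.

Set Implicit Arguments.
Unset Strict Implicit.
Unset Printing Implicit Defensive.

Import Order.TTheory GRing.Theory Num.Theory.

Local Open Scope ring_scope.

(** * Balanced cut points along a nondecreasing function *)

Definition cuts (k m : nat) (z : nat -> nat) : Prop :=
  [/\ z 0%N = 0%N, z k = m & forall i, (i < k)%N -> (z i <= z i.+1)%N].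

Definition gap (R : realType) (v : nat -> R) (z : nat -> nat) (i : nat) : R :=
  v (z i.+1) - v (z i).

Lemma cuts_leq (k m : nat) (z : nat -> nat) (i j : nat) :
  cuts k m z -> (i <= j <= k)%N -> (z i <= z j)%N.
Proof.
move=> [_ _ zS]; elim: j => [|j IHj]; first by rewrite leqn0 => /andP[/eqP->].
rewrite leq_eqVlt => /andP[/orP[/eqP->//|lt_ij] lt_jk].
by apply: leq_trans (zS _ lt_jk); apply: IHj; rewrite -ltnS lt_ij ltnW.
Qed.

Section Monotone.

Variables (R : realType) (v : nat -> R).
Hypothesis v_ndecr : forall i, v i <= v i.+1.
Hypothesis v_step : forall i, v i.+1 <= v i + 1.

Let v_homo : {homo v : i j / (i <= j)%N >-> i <= j}.
Proof. exact: (homo_leq (@lexx _ R) (@le_trans _ R)). Qed.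

(** Cut points are determined by finitely many functions from ['I_k.+1] to ['I_m.+1], so the least
    value of the largest gap is attained. *)
Lemma minimax_cuts (k m : nat) : (0 < k)%N ->
  exists h b, [/\ cuts k m h, forall i, (i < k)%N -> gap v h i <= b
    & forall z, cuts k m z -> exists2 i, (i < k)%N & b <= gap v z i].
Proof.
move=> k_gt0.
pose cut (f : {ffun 'I_k.+1 -> 'I_m.+1}) (i : nat) : nat := f (inord i).
pose Q f := [&& cut f 0 == 0, cut f k == m
                & [forall i : 'I_k, cut f i <= cut f i.+1]]%N.
pose F f := \big[Num.max/0]_(i < k) gap v (cut f) i.
have QP f : reflect (cuts k m (cut f)) (Q f).
  apply: (iffP and3P) => [[/eqP ? /eqP ? /forallP fS]|[-> -> fS]]; split=> //.
    by move=> i lt_ik; exact: fS (Ordinal lt_ik).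
  by apply/forallP => i; exact: fS.
pose code (z : nat -> nat) : {ffun 'I_k.+1 -> 'I_m.+1} := [ffun i : 'I_k.+1 => inord (z i)].
have cutK z i : cuts k m z -> (i <= k)%N -> cut (code z) i = z i.
  move=> zP le_ik; rewrite /cut ffunE !inordK // ltnS.
  by case: (zP) => _ <- _; apply: (cuts_leq zP); rewrite le_ik leqnn.
have Qcode z : cuts k m z -> Q (code z).
  move=> zP; apply/QP; case: (zP) => z0 zk zS.
  by split=> [||i lt_ik]; rewrite ?cutK // ?zS // ltnW.
have Q0 : Q (code (fun i => if i == k then m else 0)%N).
  by apply: Qcode; split=> [||i]; case: eqP => //; lia.
case: (arg_minP F Q0) => f /QP fP fmin.
exists (cut f), (F f); split=> // [i lt_ik|z zP].
  exact: (le_bigmax _ (fun i : 'I_k => gap v (cut f) i) (Ordinal lt_ik)).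
have [/existsP[i le_i]|] := boolP [exists i : 'I_k, F f <= gap v z i].
  by exists i.
move/existsPn => gap_lt; exfalso.
have lt_F (i : 'I_k) : gap v z i < F f by rewrite ltNge gap_lt.
(* The maximum in [F] starts from 0, so bounding it strictly by [F f] needs [F f] positive as well;
   gaps of the monotone [v] along [z] are nonnegative. *)
have F_gt0 : 0 < F f.
  apply: le_lt_trans (lt_F (Ordinal k_gt0)).
  by rewrite subr_ge0 v_homo //; case: zP => _ _; exact.
have := fmin _ (Qcode _ zP); apply/negP; rewrite -ltNge.
apply: bigmax_lt => // i _; apply: le_lt_trans (lt_F i).
by rewrite /gap !cutK // ltnW.
Qed.

(** Take the first [d] where the block reaches [t] or the end [m]: one position earlier it is still
    below [t], and a step of [v] adds at most 1. *)
Lemma greedy_step (m : nat) (t : R) (c : nat) : -1 < t ->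
  {d | [/\ (c <= d)%N, (d <= maxn c m)%N, v d - v c < t + 1
         & (d < m)%N -> t <= v d - v c]}.
Proof.
move=> t_gt; pose P d := (c <= d)%N && ((m <= d)%N || (t <= v d - v c)).
have exP : exists d, P d by exists (maxn c m); rewrite /P leq_maxl leq_maxr.
exists (ex_minn exP).
case: ex_minnP => d /andP[le_cd dP] dmin; split=> //.
- by apply: dmin; rewrite /P leq_maxl leq_maxr.
- have [eq_cd|lt_cd] := eqVneq c d; first by rewrite eq_cd subrr; lra.
  case: d le_cd dP dmin lt_cd => [|d] le_cd _ dmin lt_cd; first by lia.
  have /negP : ~ P d by move=> /dmin; rewrite ltnn.
  have -> : P d = (m <= d)%N || (t <= v d - v c) by rewrite /P (_ : c <= d)%N; lia.
  rewrite negb_or -ltNge => /andP[_]; have := v_step d; lra.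
by move=> lt_dm; move: dP; rewrite leqNgt lt_dm.
Qed.

Lemma greedy_cuts (k m : nat) (b : R) : (0 < k)%N -> 0 < b ->
  (forall z, cuts k m z -> exists2 i, (i < k)%N & b <= gap v z i) ->
  exists g, [/\ cuts k m g, forall i, (i < k)%N -> b - 1 <= gap v g i
    & forall i, (i.+1 < k)%N -> gap v g i <= b].
Proof.
move=> k_gt0 b_gt0 bmin.
have t_gt : -1 < b - 1 by lra.
pose r i := iter i (fun c => sval (greedy_step m c t_gt)) 0%N.
have rS i : [/\ (r i <= r i.+1)%N, (r i.+1 <= maxn (r i) m)%N, gap v r i < b
    & (r i.+1 < m)%N -> b - 1 <= gap v r i].
  rewrite /gap /r iterS -/(r i); case: greedy_step => d /= [? ? ? ?].
  by split=> //; lra.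
have r_le i : (r i <= m)%N by elim: i => // i IHi; have [] := rS i; lia.
have r_homo : {homo r : i j / (i <= j)%N}.
  by apply: homo_leq leq_trans _ => // i; have [] := rS i.
pose g i := if (i < k)%N then r i else m.
have gP : cuts k m g.
  split=> [||i lt_ik]; rewrite /g ?k_gt0 ?ltnn // lt_ik.
  by case: ifP => // _; have [] := rS i.
have gap_g i : (i.+1 < k)%N -> gap v g i = gap v r i.
  by move=> lt_ik; rewrite /gap /g lt_ik ltnW.
have last_ge : b <= gap v g k.-1.
  have [i lt_ik le_b] := bmin g gP.
  have [lt_Sik|] := ltnP i.+1 k; last by move=> ?; rewrite (_ : k.-1 = i) //; lia.
  by move: le_b; rewrite gap_g //; have [_ _ ? _] := rS i; lra.
(* Were [m] reached earlier, the last gap would be at most 0 < [b]. Hence every earlier cut was made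
   because its block reached [b - 1]. *)
have last_lt : (r k.-1 < m)%N.
  rewrite ltnNge; apply/negP => le_m; move: last_ge.
  rewrite /gap prednK // /g ltnn prednK ?leqnn //.
  by have := v_homo le_m; lra.
exists g; split=> // i lt_ik; last by rewrite gap_g //; have [_ _ /ltW] := rS i.
have [lt_Sik|le_k] := ltnP i.+1 k; last first.
  by rewrite (_ : i = k.-1); [lra|lia].
rewrite gap_g //; have [_ _ _] := rS i; apply.
by apply: leq_ltn_trans last_lt; apply: r_homo; lia.
Qed.

Lemma interpolate_cuts (k m : nat) (t : R) (g h : nat -> nat) : -1 <= t ->
  cuts k m g -> cuts k m h ->
  (forall i, (i < k)%N -> t <= gap v g i) ->
  (forall i, (i.+1 < k)%N -> gap v g i <= t + 1) ->
  (forall i, (i < k)%N -> gap v h i <= t + 1) ->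
  exists2 z, cuts k m z & forall i, (i < k)%N -> t <= gap v z i <= t + 1.
Proof.
move=> t_ge [g0 gk gS] [h0 hk _] g_lo g_up h_up.
(* The greedy cut points need not stay below [h]: once [c] has met [g], it
   follows [g] down to 0. *)
suff main j c : (j <= k)%N -> (g j <= c)%N ->
    (c <= h j)%N \/ (c = g j /\ (j < k)%N) ->
    exists2 z, cuts j c z & forall i, (i < j)%N -> t <= gap v z i <= t + 1.
  by apply: main; rewrite ?gk ?hk //; left.
elim: j c => [|j IHj] c le_jk le_gc c_up.
  by exists (fun=> 0%N) => //; split=> //; lia.
have le_gj := leq_trans (gS j le_jk) le_gc.
(* The next cut point is the least such [x]. Either it is [g j], and the gap is at least that of
   [g], or the position before it gives a gap above [t + 1], so that of [x] exceeds [t]. *)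
pose P x := (g j <= x)%N && (v c - v x <= t + 1).
have Pc : P c by rewrite /P le_gj subrr; lra.
have := ex_minnP (ex_intro P c Pc); move: ex_minn => _ [x /andP[le_gx x_up] xmin].
have x_lo : t <= v c - v x.
  have [eq_gx|neq_gx] := eqVneq (g j) x.
    rewrite -eq_gx; apply: le_trans (g_lo j le_jk) _.
    by rewrite lerD2r v_homo.
  case: x le_gx x_up xmin neq_gx => [|x] le_gx _ xmin neq_gx; first by lia.
  have /negP : ~ P x by move=> /xmin; rewrite ltnn.
  have -> : P x = (v c - v x <= t + 1) by rewrite /P (_ : g j <= x)%N; lia.
  by rewrite -ltNge; have := v_step x; lra.
(* If [c = g j.+1], block [j] of [g] is not its last and fits under [t + 1], so [x = g j]. If
   [c <= h j.+1], the gap from [h j] fits: either [h j] is a candidate, or [g j] lies beyond it and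
   is one. *)
have x_inv : (x <= h j)%N \/ (x = g j /\ (j < k)%N).
  have [c_le|[c_eq lt_jk]] := c_up; last first.
    right; split; [apply/eqP; rewrite eqn_leq le_gx andbT|lia].
    by apply: xmin; rewrite /P leqnn c_eq; exact: g_up.
  have h_c : v c - v (h j) <= t + 1.
    by apply: le_trans (h_up j le_jk); rewrite lerD2r v_homo.
  have [le_gh|lt_hg] := leqP (g j) (h j).
    by left; apply: xmin; rewrite /P le_gh.
  right; split=> //; apply/eqP; rewrite eqn_leq le_gx andbT.
  apply: xmin; rewrite /P leqnn; have := v_homo (ltnW lt_hg); lra.
have [z [z0 zj zS] z_gap] := IHj x (ltnW le_jk) le_gx x_inv.
pose z' i := if (i <= j)%N then z i else c.
have z'E i : (i <= j)%N -> z' i = z i by rewrite /z' => ->.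
have z'c : z' j.+1 = c by rewrite /z' ltnn.
exists z'.
  split=> // i; rewrite ltnS leq_eqVlt => /orP[/eqP->|lt_ij].
    by rewrite z'c z'E // zj; exact: xmin.
  by rewrite !z'E ?zS // ltnW.
move=> i; rewrite ltnS leq_eqVlt => /orP[/eqP->|lt_ij].
  by rewrite /gap z'c z'E // zj x_lo.
by rewrite /gap !z'E // 1?ltnW // z_gap.
Qed.

Lemma balanced_cuts (k m : nat) : (0 < k)%N ->
  exists z t, cuts k m z /\ forall i, (i < k)%N -> t <= gap v z i <= t + 1.
Proof.
move=> k_gt0; have [h [b [hP h_up bmin]]] := minimax_cuts m k_gt0.
have [b_le0|b_gt0] := leP b 0.
  (* Gaps are nonnegative and at most [b], so here they all vanish. *)
  exists h, 0; split=> // i lt_ik; have := h_up i lt_ik.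
  have : 0 <= gap v h i by rewrite subr_ge0 v_homo //; case: hP => _ _; exact.
  by move=> ? ?; apply/andP; split; lra.
have [g [gP g_lo g_up]] := greedy_cuts k_gt0 b_gt0 bmin.
have t_ge : -1 <= b - 1 by lra.
have [||z zP z_gap] := interpolate_cuts t_ge gP hP g_lo.
- by move=> i ?; rewrite subrK; exact: g_up.
- by move=> i ?; rewrite subrK; exact: h_up.
by exists z, (b - 1).
Qed.

End Monotone.

(** * Reduction to nondecreasing prefix sums *)

Section Records.

Variables (R : realType) (s : nat -> R) (T : R).

Fixpoint record (i : nat) : nat :=
  if i is i'.+1 then
    if s (record i') <= s i <= T then i else record i'
  else 0%N.

Lemma record_leq (i : nat) : (record i <= i)%N.
Proof. by elim: i => //= i IHi; case: ifP => // _; exact: leqW. Qed.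

Lemma record_homo : {homo record : i j / (i <= j)%N}.
Proof.
apply: homo_leq leq_trans _ => // i /=.
by case: ifP => // _; apply: leqW; exact: record_leq.
Qed.

Lemma record_ndecr (i : nat) : s (record i) <= s (record i.+1).
Proof. by rewrite /=; case: ifP => // /andP[]. Qed.

Hypothesis s_step : forall i, s i.+1 <= s i + 1.
Hypothesis s0_le : s 0%N <= T.

Lemma record_le (i : nat) : s (record i) <= T.
Proof. by elim: i => //= i IHi; case: ifP => // /andP[]. Qed.

(** When a step carries [s] above [T] from a value at most the kept one, the kept one is at least
    [T - 1], and later kept values are no smaller. Either alternative bounds the next kept value by
    the current one plus 1. *)
Lemma record_near (i : nat) : s i <= s (record i) \/ T <= s (record i) + 1.
Proof.
elim: i => [|i IHi]; first by left.
rewrite /=; case: ifPn => [_|]; first by left.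
rewrite negb_and -!ltNge => /orP[/ltW|lt_T]; first by left.
by case: IHi => ?; right => //; have := s_step i; lra.
Qed.

Lemma record_step (i : nat) : s (record i.+1) <= s (record i) + 1.
Proof.
rewrite /=; case: ifP => [/andP[_ le_T]|_]; last by lra.
by case: (record_near i) => ?; have := s_step i; lra.
Qed.

Lemma record_last (i : nat) : s i = T -> record i = i.
Proof. by case: i => //= i ->; rewrite record_le lexx. Qed.

End Records.

(** * Block sizes as differences of prefix sums *)

Definition prefix_sum (R : realType) (n : nat) (a : 'I_n -> R) (i : nat) : R :=
  \sum_(j < n | (j < i)%N) a j.

Lemma block_size_interval (R : realType) (n : nat) (a : 'I_n -> R) (x y : nat) :
  (x <= y)%N ->
  block_size a [set j : 'I_n | (x <= j < y)%N]
    = prefix_sum a y - prefix_sum a x.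
Proof.
move=> le_xy; apply/eqP; rewrite eq_sym subr_eq; apply/eqP.
rewrite /prefix_sum (bigID (fun j : 'I_n => x <= j)%N) /=; congr (_ + _).
  by apply: eq_bigl => j; rewrite inE andbC.
by apply: eq_bigl => j; lia.
Qed.

Lemma prefix_sum_step (R : realType) (n : nat) (a : 'I_n -> R) (i : nat) :
  (forall j, a j <= 1) -> prefix_sum a i.+1 <= prefix_sum a i + 1.
Proof.
move=> a_le1; rewrite -lerBlDl -block_size_interval // /block_size.
have [lt_in|le_ni] := ltnP i n.
  rewrite (big_pred1 (Ordinal lt_in)) // => j.
  by rewrite inE /= -val_eqE /=; lia.
by rewrite big_pred0 // => j; rewrite inE; have := ltn_ord j; lia.
Qed.

Theorem theorem2p4 (R : realType) (n k : nat) (hk : (0 < k)%N)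
    (a : 'I_n -> R) (ha : forall i : 'I_n, a i <= 1)
    (hS : 0 <= \sum_(i < n) a i) :
  exists B : 'I_k -> {set 'I_n},
    is_block_partition B /\
    family_max hk (fun i => block_size a (B i))
      <= family_min hk (fun i => block_size a (B i)) + 1.
Proof.
pose s := prefix_sum a; pose p := record s (s n).
have s_step i : s i.+1 <= s i + 1 by exact: prefix_sum_step.
(* This is where [hS] enters: the scan starts from a value not above its target. *)
have s0_le : s 0%N <= s n.
  rewrite /s /prefix_sum big_pred0 // (eq_bigl xpredT) // => j.
  exact: ltn_ord.
(* The cut points [z] balance [s \o p]; since [p] is monotone and fixes 0 and [n], the points
   [p (z i)] cut the original sequence. *)
have [z [t [[z0 zk zS] z_gap]]] := balanced_cuts
  (record_ndecr s (s n)) (record_step (s n) s_step) n hk.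
have xS (i : 'I_k) : (p (z i) <= p (z i.+1))%N by exact/record_homo/zS.
pose B (i : 'I_k) := [set j : 'I_n | (p (z i) <= j < p (z i.+1))%N].
have B_size i : t <= block_size a (B i) <= t + 1.
  by rewrite block_size_interval ?xS //; exact: z_gap.
exists B; split.
  exists (p \o z); split=> //=; first by rewrite z0.
    by rewrite zk; exact: record_last.
  by move=> i lt_ik; exact: xS (Ordinal lt_ik).
have B_lo i : t <= block_size a (B i) by case/andP: (B_size i).
have B_up i : block_size a (B i) <= t + 1 by case/andP: (B_size i).
apply: (@le_trans _ _ (t + 1)); first exact: bigmax_le.
by rewrite lerD2r; exact: le_bigmin.
Qed.
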